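(* Let $m\ge 2$ be an integer, $A=[a]_m$, $B=[b]_m\in\mathbb{Z}_m$, and let $F_n=[f_n]_m$ $(n\in\mathbb{Z}_+)$ be a sequence in $\mathbb{Z}_m$, where $a,b,f_n\in\mathbb{Z}$. Let $m_1,m_2,\pi_i,A_i,B_i,F_{i,n},\psi$ be as defined in the context, and suppose $m_1\neq1$ and $m_2\ne1$. Let $\{X_{1,n}\}_{n=0}^\infty$ and $\{X_{2,n}\}_{n=0}^\infty$ be sequences in $\mathbb{Z}_{m_1}$ and $\mathbb{Z}_{m_2}$ respectively. The sequence $$X_n=\psi(X_{1,n},X_{2,n}),\quad n\in\mathbb{Z}_+,$$ is a solution of $$BX_{n+1}=AX_n+F_n,\quad n\in\mathbb{Z}_+,$$ over $\mathbb{Z}_m$ if and only if $\{X_{1,n}\}_{n=0}^\infty$ and $\{X_{2,n}\}_{n=0}^\infty$ are solutions of $$B_1X_{1,n+1}=A_1X_{1,n}+F_{1,n}\quad\text{and}\quad B_2X_{2,n+1}=A_2X_{2,n}+F_{2,n}\qquad(n\in\mathbb{Z}_+)$$ over $\mathbb{Z}_{m_1}$ and $\mathbb{Z}_{m_2}$, respectively. Moreover, $X_{i,n}=\pi_i(X_n)$ for $i=1,2$ and $n\in\mathbb{Z}_+$.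
   Context: $\mathbb{Z}_+$ is the set of non-negative integers. $\mathbb{Z}_s=\mathbb{Z}/s\mathbb{Z}$ and $[t]_s$ is the class of $t\in\mathbb{Z}$ in $\mathbb{Z}_s$. Write $m=\prod_{j=1}^r p_j^{k_j}$ with distinct primes $p_j$ and integers $k_j\ge1$. Put $m_1=\prod_{j:\,p_j\nmid b}p_j^{k_j}$, $m_2=\prod_{j:\,p_j\mid b}p_j^{k_j}$ (empty products are $1$); so $m=m_1m_2$ and $\gcd(m_1,m_2)=1$. For $i=1,2$, $\pi_i:\mathbb{Z}_m\to\mathbb{Z}_{m_i}$ is the natural projection $\pi_i([t]_m)=[t]_{m_i}$, and $A_i=\pi_i(A)$, $B_i=\pi_i(B)$, $F_{i,n}=\pi_i(F_n)$. $\psi:\mathbb{Z}_{m_1}\oplus\mathbb{Z}_{m_2}\to\mathbb{Z}_m$ is the ring isomorphism $\psi([t_1]_{m_1},[t_2]_{m_2})=[t_1e_1m_2+t_2e_2m_1]_m$, where $[e_1]_{m_1}=[m_2]_{m_1}^{-1}$, $[e_2]_{m_2}=[m_1]_{m_2}^{-1}$. *)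

(* Defs.v *)
From HB Require Import structures.
From mathcomp Require Import all_boot all_order all_algebra.

Set Implicit Arguments.
Unset Strict Implicit.
Unset Printing Implicit Defensive.

Import GRing.Theory.
Local Open Scope ring_scope.

(* The residue class [t]_s of t : int is t%:~R : 'Z_s. The type 'Z_s is Z/sZ
   only for 1 < s, which holds for every modulus used in the statement. *)

Definition part_prime_to (m : nat) (b : int) : nat :=
  (\prod_(p <- primes m | ~~ (p%:Z %| b)%Z) p ^ logn p m)%N.

Definition part_dividing (m : nat) (b : int) : nat :=
  (\prod_(p <- primes m | (p%:Z %| b)%Z) p ^ logn p m)%N.

(* Computed on the representative of x in [0, m); Zp_proj_int shows that the
   representative is irrelevant when d divides m. *)
Definition Zp_proj (m d : nat) (x : 'Z_m) : 'Z_d := (val x)%:R.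
Arguments Zp_proj {m} d x.

(* Computed on the representatives of x.1 and x.2; Zp_psi_int shows that they
   are irrelevant when m = m1 * m2. *)
Definition Zp_psi (m m1 m2 : nat) (e1 e2 : int) (x : 'Z_m1 * 'Z_m2) : 'Z_m :=
  ((val x.1)%:Z * e1 * m2%:Z + (val x.2)%:Z * e2 * m1%:Z)%:~R.
Arguments Zp_psi m {m1 m2} e1 e2 x.

Definition is_solution (R : pzRingType) (A B : R) (F X : nat -> R) : Prop :=
  forall n : nat, B * X n.+1 = A * X n + F n.

Lemma Zp_int_eq (s : nat) (t u : int) :
  (1 < s)%N -> (t%:~R == u%:~R :> 'Z_s) = (s%:Z %| t - u)%Z.
Proof.
move=> s1; rewrite -subr_eq0 -rmorphB /=.
have nat0 k : (k%:R == 0 :> 'Z_s) = (s %| k)%N.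
  by rewrite -(inj_eq val_inj) /= val_Zp_nat.
rewrite dvdzE /=; case: (t - u) => k; first by rewrite -nat0.
by rewrite NegzE rmorphN /= oppr_eq0 -nat0.
Qed.

Lemma Zp_int_val (s : nat) (x : 'Z_s) : ((val x)%:Z)%:~R = x.
Proof. exact: natr_Zp. Qed.

Lemma Zp_val_int (s : nat) (t : int) :
  (1 < s)%N -> (s%:Z %| (val (t%:~R : 'Z_s))%:Z - t)%Z.
Proof. by move=> s1; rewrite -Zp_int_eq // Zp_int_val. Qed.

Lemma Zp_proj_int (m d : nat) (t : int) :
  (1 < m)%N -> (1 < d)%N -> (d %| m)%N ->
  Zp_proj d (t%:~R : 'Z_m) = t%:~R.
Proof.
move=> m1 d1 dm; apply/eqP.
have -> : Zp_proj d (t%:~R : 'Z_m) = ((val (t%:~R : 'Z_m))%:Z)%:~R by [].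
by rewrite Zp_int_eq //; apply: dvdz_trans (Zp_val_int t m1); rewrite dvdzE.
Qed.

Lemma Zp_psi_int (m m1 m2 : nat) (e1 e2 t1 t2 : int) :
  (1 < m1)%N -> (1 < m2)%N -> m = (m1 * m2)%N ->
  Zp_psi m e1 e2 ((t1%:~R : 'Z_m1), (t2%:~R : 'Z_m2)) =
    (t1 * e1 * m2%:Z + t2 * e2 * m1%:Z)%:~R.
Proof.
move=> h1 h2 ->; have h : (1 < m1 * m2)%N.
  exact: (leq_trans h1 (leq_pmulr _ (ltnW h2))).
apply/eqP; rewrite Zp_int_eq //= opprD addrACA -!mulrBl.
have d1 := Zp_val_int t1 h1; have d2 := Zp_val_int t2 h2.
rewrite PoszM; apply: rpredD.
  by apply: dvdz_mul; [apply: dvdz_mulr | apply: dvdzz].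
by rewrite [X in (X %| _)%Z]mulrC; apply: dvdz_mul; [apply: dvdz_mulr | apply: dvdzz].
Qed.

(* Main.v *)
Require Import Defs.
From HB Require Import structures.
From mathcomp Require Import all_boot all_order all_algebra.

Set Implicit Arguments.
Unset Strict Implicit.
Unset Printing Implicit Defensive.

Import GRing.Theory.
Local Open Scope ring_scope.

(** This is the Chinese remainder theorem applied to the equation. Since [m = m1 * m2] ([mul_parts])
    with coprime factors ([coprime_parts]), the two projections are additive and multiplicative
    ([Zp_projD], [Zp_projM]) and jointly injective ([Zp_proj_inj]), and [Zp_psi] is a right inverse
    of the pair ([Zp_proj_psi]). Hence [X n] projects to [X1 n] and [X2 n], and the equation for [X]
    holds at [n] exactly when both of its projections do. *)

Lemma mul_parts (m : nat) (b : int) :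
  (0 < m)%N -> (part_prime_to m b * part_dividing m b)%N = m.
Proof.
move=> m0; rewrite {3}(prod_prime_decomp m0) prime_decompE big_map /=.
by rewrite (bigID (fun p : nat => (p%:Z %| b)%Z)) mulnC.
Qed.

(** A prime factor of the first product does not divide [b] while one of the second does, so the two
    primes differ and their powers are coprime. *)
Lemma coprime_parts (m : nat) (b : int) :
  coprime (part_prime_to m b) (part_dividing m b).
Proof.
rewrite /part_prime_to /part_dividing.
(* This keeps membership in [primes m] available during the inductions; primality comes from it. *)
rewrite big_seq_cond [X in coprime _ X]big_seq_cond.
elim/big_ind: _ => [|x y cx cy|p /andP[pm pNb]].
- exact: coprime1n.
- by rewrite coprimeMl cx.
elim/big_ind: _ => [|x y cx cy|q /andP[qm qb]].
- exact: coprimen1.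
- by rewrite coprimeMr cx.
move: pm qm; rewrite !mem_primes => /andP[p_pr _] /andP[q_pr _].
apply/coprimeXl/coprimeXr; rewrite prime_coprime // dvdn_prime2 //.
by apply: contraNneq pNb => ->.
Qed.

Section Projection.

Variables m d : nat.
Hypotheses (m_gt1 : (1 < m)%N) (d_gt1 : (1 < d)%N) (dvd_dm : (d %| m)%N).

(** Every class comes from an integer, and since [d] divides [m], projecting that class is reducing
    the integer modulo [d]; additivity is inherited from [int]. *)
Lemma Zp_projD (x y : 'Z_m) : Zp_proj d (x + y) = Zp_proj d x + Zp_proj d y.
Proof.
rewrite -(Zp_int_val x) -(Zp_int_val y) -rmorphD.
by rewrite !(Zp_proj_int _ m_gt1 d_gt1 dvd_dm) rmorphD.
Qed.

Lemma Zp_projM (x y : 'Z_m) : Zp_proj d (x * y) = Zp_proj d x * Zp_proj d y.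
Proof.
rewrite -(Zp_int_val x) -(Zp_int_val y) -rmorphM.
by rewrite !(Zp_proj_int _ m_gt1 d_gt1 dvd_dm) rmorphM.
Qed.

End Projection.

Section ChineseRemainder.

Variables m m1 m2 : nat.
Hypotheses (m_gt1 : (1 < m)%N) (m1_gt1 : (1 < m1)%N) (m2_gt1 : (1 < m2)%N).
Hypotheses (mE : m = (m1 * m2)%N) (co12 : coprime m1 m2).

Let dvd1 : (m1 %| m)%N. Proof. by rewrite mE dvdn_mulr. Qed.
Let dvd2 : (m2 %| m)%N. Proof. by rewrite mE dvdn_mull. Qed.

(** A difference of representatives divisible by both coprime factors is divisible by their product
    [m]. *)
Lemma Zp_proj_inj (x y : 'Z_m) :
  Zp_proj m1 x = Zp_proj m1 y -> Zp_proj m2 x = Zp_proj m2 y -> x = y.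
Proof.
rewrite -(Zp_int_val x) -(Zp_int_val y).
rewrite !(Zp_proj_int _ m_gt1 m1_gt1 dvd1) !(Zp_proj_int _ m_gt1 m2_gt1 dvd2).
move=> /eqP e1 /eqP e2; apply/eqP; move: e1 e2; rewrite !Zp_int_eq //.
by rewrite !dvdzE /=; have := Gauss_dvd _ co12; rewrite -mE => -> -> ->.
Qed.

Lemma Zp_proj_psi (e1 e2 : int) (x1 : 'Z_m1) (x2 : 'Z_m2) :
  e1%:~R = (m2%:R)^-1 :> 'Z_m1 -> e2%:~R = (m1%:R)^-1 :> 'Z_m2 ->
  Zp_proj m1 (Zp_psi m e1 e2 (x1, x2)) = x1 /\
  Zp_proj m2 (Zp_psi m e1 e2 (x1, x2)) = x2.
Proof.
move=> he1 he2; rewrite /Zp_psi !Zp_proj_int // !rmorphD !rmorphM /=.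
(* Modulo [m1] the summand containing [m1] vanishes, and likewise for [m2], leaving [x1 / m2 * m2]
   and [x2 / m1 * m1]. *)
rewrite !Zp_int_val he1 he2 -!pmulrn !pchar_Zp // !mulr0 addr0 add0r.
(* Coprimality makes each modulus a unit modulo the other, so the inverses in [he1] and [he2] are
   genuine ones. *)
by split; rewrite divrK // unitZpE // coprime_sym.
Qed.

End ChineseRemainder.

Theorem lemma2p1 (m : nat) (hm : (2 <= m)%N) (a b : int) (f : nat -> int)
  (A B : 'Z_m) (F : nat -> 'Z_m)
  (hA : A = a%:~R) (hB : B = b%:~R) (hF : forall n, F n = (f n)%:~R)
  (m1 m2 : nat)
  (hm1 : m1 = part_prime_to m b) (hm2 : m2 = part_dividing m b)
  (m1_neq1 : m1 <> 1%N) (m2_neq1 : m2 <> 1%N)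
  (e1 e2 : int)
  (he1 : e1%:~R = (m2%:R)^-1 :> 'Z_m1) (he2 : e2%:~R = (m1%:R)^-1 :> 'Z_m2)
  (X1 : nat -> 'Z_m1) (X2 : nat -> 'Z_m2) (X : nat -> 'Z_m)
  (hX : forall n, X n = Zp_psi m e1 e2 (X1 n, X2 n)) :
  (is_solution A B F X <->
     is_solution (Zp_proj m1 A) (Zp_proj m1 B) (fun n => Zp_proj m1 (F n)) X1 /\
     is_solution (Zp_proj m2 A) (Zp_proj m2 B) (fun n => Zp_proj m2 (F n)) X2)
  /\ (forall n, X1 n = Zp_proj m1 (X n) /\ X2 n = Zp_proj m2 (X n)).
Proof.
have m_gt0 : (0 < m)%N := ltnW hm.
have mE : m = (m1 * m2)%N by rewrite hm1 hm2 mul_parts.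
have co12 : coprime m1 m2 by rewrite hm1 hm2 coprime_parts.
(* Positivity turns [m1 <> 1] and [m2 <> 1] into [1 < m1] and [1 < m2], the range where ['Z_s]
   really is the ring of integers modulo [s]. *)
move: (m_gt0); rewrite {1}mE muln_gt0 => /andP[m1_gt0 m2_gt0].
have m1_gt1 : (1 < m1)%N by rewrite ltn_neqAle m1_gt0 eq_sym andbT; apply/eqP.
have m2_gt1 : (1 < m2)%N by rewrite ltn_neqAle m2_gt0 eq_sym andbT; apply/eqP.
have dvd1 : (m1 %| m)%N by rewrite mE dvdn_mulr.
have dvd2 : (m2 %| m)%N by rewrite mE dvdn_mull.
have projX n : Zp_proj m1 (X n) = X1 n /\ Zp_proj m2 (X n) = X2 n.
  by rewrite hX; apply: Zp_proj_psi.
split; last by move=> n; have [-> ->] := projX n.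
split=> [solX | [sol1 sol2] n].
  split=> n.
    have [<- _] := projX n; have [<- _] := projX n.+1.
    by rewrite -!Zp_projM // -Zp_projD // solX.
  have [_ <-] := projX n; have [_ <-] := projX n.+1.
  by rewrite -!Zp_projM // -Zp_projD // solX.
have [X1n X2n] := projX n; have [X1Sn X2Sn] := projX n.+1.
(* An equality in ['Z_m] may be checked after both projections, where it becomes the two given
   equations. *)
apply: (Zp_proj_inj hm m1_gt1 m2_gt1 mE co12); rewrite Zp_projD // !Zp_projM //.
  by rewrite X1n X1Sn sol1.
by rewrite X2n X2Sn sol2.
Qed.
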